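(* Let $\mathbf{s}_1,\mathbf{s}_2\in\mathsf{V}$ be consistently oriented unit-spacelike vectors and let $p_1,p_2\in\mathsf{E}$. Then the closed crooked halfspaces $\overline{\mathcal{H}}(p_1,\mathbf{s}_1)$ and $\overline{\mathcal{H}}(p_2,\mathbf{s}_2)$ are disjoint if and only if $$p_1-p_2\in\mathsf{A}(\mathbf{s}_1,\mathbf{s}_2).$$ Similarly, $\mathcal{H}(p_1,\mathbf{s}_1)\cap\mathcal{H}(p_2,\mathbf{s}_2)=\emptyset$ if and only if $p_1-p_2$ lies in the closure of $\mathsf{A}(\mathbf{s}_1,\mathbf{s}_2)$.
   Context: $\mathsf{V}$ is an oriented real $3$-dimensional vector space with an inner product $\mathbf{u}\cdot\mathbf{v}$ of signature $(2,1)$ and a chosen time-orientation: one of the two components of the set of timelike vectors ($\mathbf{v}\cdot\mathbf{v}<0$) is selected and called $\mathsf{Future}$. A nonzero non-spacelike vector is future-pointing if it lies in the closure of $\mathsf{Future}$. $\mathsf{E}$ (Minkowski space) is an affine space with group of translations $\mathsf{V}$. A vector $\mathbf{s}$ is unit-spacelike if $\mathbf{s}\cdot\mathbf{s}=1$. For such $\mathbf{s}$, $\mathbf{s}^-,\mathbf{s}^+\in\mathbf{s}^\perp$ denote future-pointing null vectors with $\mathbf{s}^-\cdot\mathbf{s}^+=-1$ such that $(\mathbf{s},\mathbf{s}^-,\mathbf{s}^+)$ is a positively oriented basis of $\mathsf{V}$ (they are unique up to $(\mathbf{s}^-,\mathbf{s}^+)\mapsto(\lambda\mathbf{s}^-,\lambda^{-1}\mathbf{s}^+)$,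 $\lambda>0$, and nothing below depends on this choice). For $p\in\mathsf{E}$ and $\mathbf{s}$ unit-spacelike, the (open) crooked halfspace with vertex $p$ and director $\mathbf{s}$ is $$\mathcal{H}(p,\mathbf{s})=\{q: (q-p)\cdot\mathbf{s}^+<0,\ (q-p)\cdot\mathbf{s}>0\}\cup\{q:(q-p)\cdot\mathbf{s}^+<0,\ (q-p)\cdot\mathbf{s}^->0,\ (q-p)\cdot\mathbf{s}=0\}\cup\{q:(q-p)\cdot\mathbf{s}^->0,\ (q-p)\cdot\mathbf{s}<0\}.$$ Its closure is the closed crooked halfspace $$\overline{\mathcal{H}}(p,\mathbf{s})=\{q:(q-p)\cdot\mathbf{s}^+\le0,\ (q-p)\cdot\mathbf{s}\ge0\}\cup\{q:(q-p)\cdot\mathbf{s}^-\ge0,\ (q-p)\cdot\mathbf{s}\le0\}.$$ $\mathbf{s}_1,\mathbf{s}_2$ are consistently oriented if $\mathbf{s}_1\cdot\mathbf{s}_2<0$, $\mathbf{s}_1\cdot\mathbf{s}_2^{\pm}\le0$ and $\mathbf{s}_1^{\pm}\cdot\mathbf{s}_2\le0$. The translational semigroup is $\mathsf{V}(\mathbf{s})=\{\mathbf{v}\in\mathsf{V}:\mathcal{H}(p,\mathbf{s})+\mathbf{v}\subset\mathcal{H}(p,\mathbf{s})\}$, which does not depend on $p$. Write $\mathsf{V}(\mathbf{s}_1)-\mathsf{V}(\mathbf{s}_2)=\{\mathbf{v}_1-\mathbf{v}_2:\mathbf{v}_i\in\mathsf{V}(\mathbf{s}_i)\}$. The cone of allowable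 translations $\mathsf{A}(\mathbf{s}_1,\mathbf{s}_2)$ is the interior of $\mathsf{V}(\mathbf{s}_1)-\mathsf{V}(\mathbf{s}_2)$.
   Formalization: The second equivalence (open halfspaces, closure of A) is stated only for s2 ≠ −s1: if s2 = −s1, which is consistently oriented, A(s1,s2) is empty although the open halfspaces are disjoint for p1 = p2. The first equivalence is unrestricted. *)

(* Defs.v *)
From HB Require Import structures.
From mathcomp Require Import all_boot all_order all_algebra.
From mathcomp Require Import all_classical all_reals all_analysis.
Import GRing.Theory Num.Theory numFieldNormedType.Exports.

Set Implicit Arguments.
Unset Strict Implicit.
Unset Printing Implicit Defensive.

Local Open Scope classical_set_scope.
Local Open Scope ring_scope.

(* The standard topology of a finite-dimensional real vector space, pulled back
   from 'rV[R]_n along the coordinates in a basis; it does not depend on the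
   basis. *)
Definition fintop (R : realType) (V : vectType R) : topologicalType :=
  initial_topology
    (fun v : V => \row_(i < \dim {:V}) coord (vbasis {:V}) i v).

(* The orientation is the class of the basis [orient].  [signature21] implies
   \dim {:V} = 3. *)
Record minkowski_vect (R : realType) (V : vectType R) := MinkowskiVect {
  form : {symmetric V};
  signature21 : exists2 e : 3.-tuple V, basis_of {:V} e &
    forall i j : 'I_3, form (tnth e i) (tnth e j) =
      if i == j then (if (i < 2)%N then 1 else -1) else 0;
  orient : 3.-tuple V;
  orient_basis : basis_of {:V} orient;
  Future : set V;
  Future_component : exists2 t : V, form t t < 0 &
    Future = @connected_component (fintop V) [set v : V | form v v < 0] t
}.

Record affine_space (V : zmodType) := AffineSpace {
  point :> Type;
  trans : point -> V -> point;
  pdiff : point -> point -> V;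
  trans0 : forall p, trans p 0 = p;
  transD : forall p u v, trans (trans p u) v = trans p (u + v);
  trans_pdiff : forall p q, trans p (pdiff q p) = q;
  pdiff_trans : forall p v, pdiff (trans p v) p = v
}.

Section Lorentz.
Context {R : realType} {V : vectType R} (M : minkowski_vect V).

Definition positively_oriented (u v w : V) : Prop :=
  0 < \det (\matrix_(i < 3, j < 3) coord (orient M) j (tnth [tuple u; v; w] i)).

Definition future_pointing (v : V) : Prop :=
  [/\ v != 0, form M v v <= 0 & @closure (fintop V) (Future M) v].

Definition future_null (v : V) : Prop :=
  form M v v = 0 /\ future_pointing v.

(* A unit-spacelike vector s together with an arbitrary admissible choice of
   the null vectors s^- and s^+. *)
Record director := Director {
  dir : V;
  dirm : V;
  dirp : V;
  dir_unit : form M dir dir = 1;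
  dirm_perp : form M dirm dir = 0;
  dirp_perp : form M dirp dir = 0;
  dirm_null : future_null dirm;
  dirp_null : future_null dirp;
  dirmp : form M dirm dirp = -1;
  dir_oriented : positively_oriented dir dirm dirp
}.

Definition consistently_oriented (s1 s2 : director) : Prop :=
  [/\ form M (dir s1) (dir s2) < 0,
      form M (dir s1) (dirm s2) <= 0 /\ form M (dir s1) (dirp s2) <= 0 &
      form M (dirm s1) (dir s2) <= 0 /\ form M (dirp s1) (dir s2) <= 0].

Context (E : affine_space V).

Definition crooked_halfspace (p : E) (s : director) : set E :=
  [set q | form M (pdiff q p) (dirp s) < 0 /\ form M (pdiff q p) (dir s) > 0]
  `|` [set q | [/\ form M (pdiff q p) (dirp s) < 0,
                   form M (pdiff q p) (dirm s) > 0 &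
                   form M (pdiff q p) (dir s) = 0]]
  `|` [set q | form M (pdiff q p) (dirm s) > 0 /\ form M (pdiff q p) (dir s) < 0].

Definition closed_crooked_halfspace (p : E) (s : director) : set E :=
  [set q | form M (pdiff q p) (dirp s) <= 0 /\ form M (pdiff q p) (dir s) >= 0]
  `|` [set q | form M (pdiff q p) (dirm s) >= 0 /\ form M (pdiff q p) (dir s) <= 0].

(* The inclusion holds for all p as soon as it holds for one. *)
Definition translational_semigroup (s : director) : set V :=
  [set v | forall p : E,
     [set trans q v | q in crooked_halfspace p s] `<=` crooked_halfspace p s].

Definition allowable_translations (s1 s2 : director) : set V :=
  @interior (fintop V)
    [set v1 - v2 | v1 in translational_semigroup s1
                 & v2 in translational_semigroup s2].

End Lorentz.

(* Main.v *)
(** A closed crooked halfspace is the union of two closed wedges, so, with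
    w = p1 - p2, the halfspaces are disjoint iff w lies in none of the four
    differences (wedge of s2) - (wedge of s1).  By duality each difference is
    the halfspace {w : w . n >= 0}, where n spans the intersection of the dual
    cone of the wedge of s2 with minus that of the wedge of s1.  The four
    vectors n are the facet normals of the cone V(s1) - V(s2), which is thus
    {w : w . n <= 0 for every n}; its interior is given by strict inequalities,
    and for the open halfspaces the same argument applies with strict and weak
    inequalities exchanged.  If s2 = - s1 the cone is flat, its interior is
    empty, and the closure of the interior is no longer the cone.

    Explicit normals come from the spinor map SL(2,R) -> SO(2,1): the change of
    basis from (s2, s2^-, s2^+) to (s1, s1^-, s1^+) is the symmetric square of
    a matrix [[a, b], [c, d]] of determinant 1, and consistent orientation says
    that its entries can be chosen nonnegative. *)

From mathcomp Require Import all_boot all_order all_algebra.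
From mathcomp Require Import all_classical all_reals all_analysis.
From mathcomp Require Import ring lra.
Require Import Defs.
Import Order.TTheory GRing.Theory Num.Theory numFieldNormedType.Exports.

Set Implicit Arguments.
Unset Strict Implicit.
Unset Printing Implicit Defensive.

Local Open Scope classical_set_scope.
Local Open Scope ring_scope.

Lemma det_mx3 (R : comRingType) (A : 'M[R]_3) : let i0 := ord0 in
  let i1 := lift ord0 ord0 in let i2 := lift ord0 (lift ord0 ord0) in
  \det A = A i0 i0 * (A i1 i1 * A i2 i2 - A i1 i2 * A i2 i1)
         - A i0 i1 * (A i1 i0 * A i2 i2 - A i1 i2 * A i2 i0)
         + A i0 i2 * (A i1 i0 * A i2 i1 - A i1 i1 * A i2 i0).
Proof.
move=> i0 i1 i2; rewrite (expand_det_row _ ord0) !big_ord_recl big_ord0 /cofactor.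
rewrite !(expand_det_row _ ord0) !big_ord_recl !big_ord0 /cofactor !det_mx11.
rewrite !mxE /= -!/i0 -!/i1 -!/i2.
have -> : lift (lift ord0 ord0) 0 = ord0 :> 'I_2 by apply: val_inj.
rewrite -!/i1; have -> : lift i1 ord0 = i0 by apply: val_inj.
have -> : lift i1 (lift ord0 ord0) = i2 by apply: val_inj.
have -> : lift i2 ord0 = i0 by apply: val_inj.
have -> : lift i2 (lift ord0 ord0) = i1 by apply: val_inj.
rewrite /bump /= !expr0 !expr1 !expr2. ring.
Qed.

(** * The Lorentzian form and the null frame of a director *)

Section Lorentz.
Context {R : realType} {V : vectType R} (M : minkowski_vect V).
Implicit Types (u v w q : V) (s : director M).

Local Notation "u ∙ v" := (Defs.form M u v) (at level 35).

Lemma formC u v : u ∙ v = v ∙ u.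
Proof. by rewrite hermC expr0 mul1r. Qed.

Lemma formDl u v w : (u + v) ∙ w = u ∙ w + v ∙ w.
Proof. exact: linearDl. Qed.

Lemma formZl (a : R) u v : (a *: u) ∙ v = a * (u ∙ v).
Proof. exact: linearZl_LR. Qed.

Lemma formNl u v : (- u) ∙ v = - (u ∙ v).
Proof. by rewrite -scaleN1r formZl mulN1r. Qed.

Lemma form0l u : 0 ∙ u = 0.
Proof. by rewrite -(scale0r u) formZl mul0r. Qed.

Lemma formDr u v w : w ∙ (u + v) = w ∙ u + w ∙ v.
Proof. by rewrite formC formDl !(formC w). Qed.

Lemma formZr (a : R) u v : v ∙ (a *: u) = a * (v ∙ u).
Proof. by rewrite formC formZl formC. Qed.

Lemma formNr u v : v ∙ (- u) = - (v ∙ u).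
Proof. by rewrite formC formNl formC. Qed.

Definition formE := (formDl, formZl, formNl, form0l, formDr, formZr, formNr).

Lemma dim_minkowski : \dim {:V} = 3.
Proof. by have [e be _] := signature21 M; exact: size_basis be. Qed.

Lemma dirm_isotropic s : dirm s ∙ dirm s = 0.
Proof. by case: (dirm_null s). Qed.

Lemma dirp_isotropic s : dirp s ∙ dirp s = 0.
Proof. by case: (dirp_null s). Qed.

Definition dirE s := (dir_unit s, dirm_perp s, dirp_perp s, dirm_isotropic s,
  dirp_isotropic s, dirmp s, formC (dir s) (dirm s), formC (dir s) (dirp s),
  formC (dirp s) (dirm s)).

(** Pairing with [dir s], [dirp s] and [dirm s] isolates each coefficient up to sign, so the frame
    is free, hence a basis in dimension 3. *)
Lemma dir_expansion s v :
  v = (v ∙ dir s) *: dir s - (v ∙ dirp s) *: dirm s - (v ∙ dirm s) *: dirp s.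
Proof.
pose X := [tuple dir s; dirm s; dirp s].
have fX : free X.
  apply/freeP => k; rewrite !big_ord_recl big_ord0 addr0 /= => k0.
  have e0 := congr1 (fun x => x ∙ dir s) k0.
  have ep := congr1 (fun x => x ∙ dirp s) k0.
  have em := congr1 (fun x => x ∙ dirm s) k0.
  rewrite /= !formE !dirE in e0 ep em.
  have k_0 : k ord0 = 0 by lra.
  have k_1 : k (lift ord0 ord0) = 0 by lra.
  have k_2 : k (lift ord0 (lift ord0 ord0)) = 0 by lra.
  case=> [[|[|[|//]]] ?]; [rewrite -[RHS]k_0|rewrite -[RHS]k_1|rewrite -[RHS]k_2];
    by congr k; apply: val_inj.
have bX : basis_of {:V} X by rewrite basisEfree fX subvf dim_minkowski size_tuple.
have := coord_basis bX (memvf v); rewrite !big_ord_recl big_ord0 addr0 /=.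
set x := coord _ _ _; set y := coord _ _ _; set z := coord _ _ _ => ->.
by rewrite !formE !dirE !(mulr0, mulr1, mulrN1, addr0, add0r, opprK, scaleNr) addrA.
Qed.

Lemma form_expansion s u v :
  u ∙ v = (u ∙ dir s) * (v ∙ dir s) - (u ∙ dirp s) * (v ∙ dirm s)
        - (u ∙ dirm s) * (v ∙ dirp s).
Proof.
by rewrite [in LHS](dir_expansion s u) !formE ![_ s ∙ v]formC.
Qed.

Lemma dir_realize s (x y z : R) :
  exists q, [/\ q ∙ dir s = x, q ∙ dirm s = y & q ∙ dirp s = z].
Proof.
exists (x *: dir s - z *: dirm s - y *: dirp s).
by rewrite !formE !dirE; split; ring.
Qed.

(** The change of basis between positively oriented frames has positive determinant. By
    [dir_expansion] its columns are pairings with [dir s2], [dirp s2], [dirm s2], up to two minus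
    signs that cancel. *)
Lemma det_dir_gt0 s1 s2 :
  0 < dir s1 ∙ dir s2 *
        (dirm s1 ∙ dirp s2 * dirp s1 ∙ dirm s2 - dirm s1 ∙ dirm s2 * dirp s1 ∙ dirp s2)
    - dir s1 ∙ dirp s2 *
        (dirm s1 ∙ dir s2 * dirp s1 ∙ dirm s2 - dirm s1 ∙ dirm s2 * dirp s1 ∙ dir s2)
    + dir s1 ∙ dirm s2 *
        (dirm s1 ∙ dir s2 * dirp s1 ∙ dirp s2 - dirm s1 ∙ dirp s2 * dirp s1 ∙ dir s2).
Proof.
have := dir_oriented s1; have := dir_oriented s2.
rewrite /positively_oriented; set B := matrix_of_fun _ _; set A := matrix_of_fun _ _.
move=> B0; pose X s := [tuple dir s; dirm s; dirp s].
pose P : 'M[R]_3 := \matrix_(i, j)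
  (tnth [tuple tnth (X s1) i ∙ dir s2; - (tnth (X s1) i ∙ dirp s2);
               - (tnth (X s1) i ∙ dirm s2)] j).
have -> : A = P *m B.
  apply/matrixP => i j; rewrite !mxE !big_ord_recl big_ord0 !mxE addr0.
  rewrite [in LHS](dir_expansion s2 (tnth _ i)) !(tnth_nth 0) /=.
  by rewrite !(linearB, linearZ) /= !scalerN !mulNr addrA.
rewrite det_mulmx pmulr_lgt0 // det_mx3 !mxE !(tnth_nth 0) /=.
lra.
Qed.

(** * Timelike, null and future-pointing vectors *)

Lemma form_signature : exists f0 f1 f2 : V -> R,
  (forall u v, u ∙ v = f0 u * f0 v + f1 u * f1 v - f2 u * f2 v) /\
  (forall u, f0 u = 0 -> f1 u = 0 -> f2 u = 0 -> u = 0).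
Proof.
have [e be ortho] := signature21 M.
pose k (i : 'I_3) u := coord e i u.
have ex u : u = k 0 u *: tnth e 0 + k (lift ord0 ord0) u *: tnth e (lift ord0 ord0)
    + k (lift ord0 (lift ord0 ord0)) u *: tnth e (lift ord0 (lift ord0 ord0)).
  rewrite [LHS](coord_basis be (memvf u)) !big_ord_recl big_ord0 addr0.
  by rewrite addrA !(tnth_nth 0).
exists (k 0), (k (lift ord0 ord0)), (k (lift ord0 (lift ord0 ord0))); split.
  move=> u v; rewrite [in LHS](ex u) [in LHS](ex v) !formE !ortho /=.
  by rewrite /bump /=; ring.
by move=> u u0 u1 u2; rewrite (ex u) u0 u1 u2 !scale0r !addr0.
Qed.

(** If [u ∙ u <= 0], Cauchy-Schwarz in the two positive coordinates contradicts [t ∙ t < 0] unless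
    these coordinates of [u] vanish; orthogonality to [t] then kills the third. *)
Lemma timelike_perp_gt0 t u : t ∙ t < 0 -> u ∙ t = 0 -> u != 0 -> 0 < u ∙ u.
Proof.
have [f0 [f1 [f2 [fE f_inj]]]] := form_signature.
rewrite !fE; move: (f_inj u).
move: (f0 t) (f1 t) (f2 t) (f0 u) (f1 u) (f2 u) => t0 t1 t2 u0 u1 u2 inj tt ut uN0.
have cs : (u2 * t2) ^+ 2 <= (u0 ^+ 2 + u1 ^+ 2) * (t0 ^+ 2 + t1 ^+ 2).
  have -> : u2 * t2 = u0 * t0 + u1 * t1 by lra.
  by have := sqr_ge0 (u0 * t1 - u1 * t0); nra.
rewrite ltNge; apply/negP => uu.
have u01 : (u0 ^+ 2 + u1 ^+ 2) * (t2 ^+ 2 - t0 ^+ 2 - t1 ^+ 2) <= 0.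
  by have : 0 <= t2 ^+ 2 * (u2 ^+ 2 - u0 ^+ 2 - u1 ^+ 2);
    [apply: mulr_ge0; nra | nra].
have {}u01 : u0 ^+ 2 + u1 ^+ 2 <= 0 by nra.
have u00 : u0 = 0 by apply/eqP; rewrite -sqrf_eq0; apply/eqP; nra.
have u10 : u1 = 0 by apply/eqP; rewrite -sqrf_eq0; apply/eqP; nra.
have t20 : t2 != 0 by apply/eqP => t20; move: tt; rewrite t20; clear; nra.
move: ut; rewrite u00 u10 !mul0r !add0r => /eqP.
rewrite oppr_eq0 mulf_eq0 (negPf t20) orbF => /eqP u20.
by move: uN0; rewrite inj // eqxx.
Qed.

Lemma form_continuousl v : continuous (fun u : fintop V => u ∙ v ).
Proof.
pose k u := \row_(i < \dim {:V}) coord (vbasis {:V}) i u.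
pose l (x : 'rV[R]_(\dim {:V}))  := \sum_i x 0 i * ((vbasis {:V})`_i ∙ v).
have -> : (fun u : fintop V => u ∙ v ) = l \o k.
  apply/funext => u; rewrite /= {1}(coord_vbasis (memvf (u : V))).
  rewrite (big_morph (fun x => x ∙ v) (fun x y => formDl x y v) (form0l v)).
  apply: eq_bigr => i _.
  by rewrite formZl mxE.
have l_cont : continuous l.
  apply: continuous_big => [x|i _ x]; first exact: add_continuous.
  by apply: cvgM; [exact: (nbhs_filter x)|exact: coord_continuous|exact: cst_continuous].
by move=> u; apply: continuous_comp; [exact: initial_continuous|exact: l_cont].
Qed.

Lemma line_continuous u v : continuous (fun x : R => (u + x *: v : fintop V)).
Proof.
pose k w := \row_(i < \dim {:V}) coord (vbasis {:V}) i w.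
apply: continuous_comp_initial => x.
rewrite (_ : _ \o _ = fun y : R => k u + y *: k v); last first.
  by apply/funext => y; apply/rowP => i; rewrite !mxE linearD linearZ.
by apply: cvgD; [exact: cst_continuous|exact: scalel_continuous].
Qed.

Lemma closed_form_le0 v : closed ([set u | u ∙ v <= 0] : set (fintop V)).
Proof. exact: (continuous_closedP _).1 (@form_continuousl v) _ (@closed_le _ 0). Qed.

Lemma open_form_lt0 v : open ([set u | u ∙ v < 0] : set (fintop V)).
Proof. exact: (continuousP _).1 (@form_continuousl v) _ (@open_lt _ 0). Qed.

(** Pairing with [t] maps a connected set to an interval: a positive value would force the value 0,
    which [timelike_perp_gt0] excludes on timelike vectors. The weak inequality passes to the
    closure. *)
Lemma Future_form t : t ∙ t < 0 -> Future M =
   @connected_component (fintop V) [set v | v ∙ v < 0] t ->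
  forall v, @closure (fintop V) (Future M) v -> v ∙ t <= 0.
Proof.
move=> tt ->.
suff sub : @connected_component (fintop V) [set v | v ∙ v < 0] t `<=`
    ([set u | u ∙ t <= 0] : set (fintop V)).
  by move=> v /(closureS sub); rewrite -(closure_id _).1 //; exact: closed_form_le0.
move=> v [C [Ct Cneg Cconn] Cv] /=; rewrite leNgt; apply/negP => vt.
have /connected_intervalP itvC : connected ((fun u : fintop V => u ∙ t) @` C).
  apply: connected_continuous_connected => //.
  by apply: continuous_subspaceT; exact: form_continuousl.
have [u Cu ut] : ((fun u : fintop V => u ∙ t) @` C) 0.
  by apply: (itvC (t ∙ t) (v ∙ t)); [exists t|exists v|rewrite ltW //= ltW].
have uu : u ∙ u < 0 by exact: Cneg.
have [u0|/eqP uN0] := pselect (u = 0); first by move: uu; rewrite u0 form0l ltxx.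
by have := timelike_perp_gt0 tt ut uN0; rewrite ltNge (ltW uu).
Qed.

(* The combination x of u and v is orthogonal to the timelike t, hence x . x >= 0. *)
Lemma future_null_form u v : future_null M u -> future_null M v -> u ∙ v <= 0.
Proof.
move=> [uu [uN0 _ uF]] [vv [vN0 _ vF]].
have [t tt Ft] := Future_component M.
have ut_lt0 w : w ∙ w = 0 -> w != 0 -> w ∙ t <= 0 -> w ∙ t < 0.
  move=> ww wN0; rewrite lt_neqAle => ->; rewrite andbT; apply/eqP => wt.
  by have := timelike_perp_gt0 tt wt wN0; rewrite ww ltxx.
have ut := ut_lt0 _ uu uN0 (Future_form tt Ft uF).
have vt := ut_lt0 _ vv vN0 (Future_form tt Ft vF).
pose x := (v ∙ t) *: u - (u ∙ t) *: v.
have xt : x ∙ t = 0 by rewrite !formE; ring.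
have xx : x ∙ x = -2 * ((u ∙ t) * (v ∙ t)) * (u ∙ v).
  by rewrite !formE uu vv (formC v u); ring.
have x0 : 0 <= x ∙ x.
  have [->|xN0] := eqVneq x 0; first by rewrite form0l.
  by rewrite ltW // (timelike_perp_gt0 tt).
have : 0 < (u ∙ t) * (v ∙ t) by rewrite nmulr_rgt0.
by move: x0; rewrite xx; move: ((u ∙ t) * (v ∙ t)) (u ∙ v) => p q; clear; nra.
Qed.

(* The equality a d - b c = 1, rather than -1, is what the orientation gives:
   the determinant of the change of basis is (a d - b c) ^ 3. *)
Lemma gram_spinor s1 s2 : consistently_oriented s1 s2 ->
  exists a b c d : R, [/\ 0 < a, 0 <= b, 0 <= c, 0 < d & a * d - b * c = 1] /\
  let r := Num.sqrt 2 in
  [/\ dir s1 ∙ dir s2 = - (a * d + b * c),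
      dir s1 ∙ dirm s2 = - (r * a * c),
      dir s1 ∙ dirp s2 = - (r * b * d) &
  [/\ dirm s1 ∙ dir s2 = - (r * a * b),
      dirm s1 ∙ dirm s2 = - a ^+ 2,
      dirm s1 ∙ dirp s2 = - b ^+ 2 &
  [/\ dirp s1 ∙ dir s2 = - (r * c * d),
      dirp s1 ∙ dirm s2 = - c ^+ 2 &
      dirp s1 ∙ dirp s2 = - d ^+ 2]]].
Proof.
move=> [g00 [g0m g0p] [gm0 gp0]].
have gmm := future_null_form (dirm_null s1) (dirm_null s2).
have gmp := future_null_form (dirm_null s1) (dirp_null s2).
have gpm := future_null_form (dirp_null s1) (dirm_null s2).
have gpp := future_null_form (dirp_null s1) (dirp_null s2).
have Nm := form_expansion s2 (dirm s1) (dirm s1).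
have Np := form_expansion s2 (dirp s1) (dirp s1).
have N0 := form_expansion s2 (dir s1) (dir s1).
have Nmp := form_expansion s2 (dirm s1) (dirp s1).
have Tm := form_expansion s1 (dirm s2) (dirm s2).
have Tp := form_expansion s1 (dirp s2) (dirp s2).
have D := det_dir_gt0 s1 s2.
rewrite !dirE in N0 Nm Np Nmp Tm Tp.
rewrite ?[dirm s2 ∙ _ s1]formC ?[dirp s2 ∙ _ s1]formC in Tm Tp.
move: g00 g0m g0p gm0 gp0 gmm gmp gpm gpp N0 Nm Np Nmp Tm Tp D.
move: (dir s1 ∙ dir s2) (dir s1 ∙ dirm s2) (dir s1 ∙ dirp s2).
move: (dirm s1 ∙ dir s2) (dirm s1 ∙ dirm s2) (dirm s1 ∙ dirp s2).
move: (dirp s1 ∙ dir s2) (dirp s1 ∙ dirm s2) (dirp s1 ∙ dirp s2).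
move=> gp0 gpm gpp gm0 gmm gmp g00 g0m g0p; clear s1 s2.
move=> h00 h0m h0p hm0 hp0 hmm hmp hpm hpp N0 Nm Np Nmp Tm Tp D.
have sq_eq (x y : R) : 0 <= x -> 0 <= y -> x ^+ 2 = y ^+ 2 -> x = y.
  by move=> x0 y0 /eqP; rewrite eqrXn2 // => /eqP.
have [r0 r2] : 0 < Num.sqrt 2 :> R /\ Num.sqrt 2 ^+ 2 = 2 :> R.
  by rewrite sqrtr_gt0 sqr_sqrtr ?ler0n ?ltr0n.
set r : R := Num.sqrt 2 in r0 r2 *.
have root (x : R) : x <= 0 -> exists2 y, 0 <= y & x = - y ^+ 2.
  by move=> x0; exists (Num.sqrt (- x)); rewrite ?sqrtr_ge0 // sqr_sqrtr ?opprK ?oppr_ge0.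
(* Products of future null vectors are nonpositive, hence minus squares. Nullity of each vector then
   fixes the mixed entries up to a sign, which consistent orientation decides. *)
have [a a0 Ea] := root _ hmm; have [b b0 Eb] := root _ hmp.
have [c c0 Ec] := root _ hpm; have [d d0 Ed] := root _ hpp.
have mk (x y z : R) : x <= 0 -> 0 <= y -> 0 <= z -> x ^+ 2 = 2 * y ^+ 2 * z ^+ 2 ->
    x = - (r * y * z).
  move=> x0 y0 z0 xx; rewrite -[LHS]opprK; congr (- _); apply: sq_eq.
  - by rewrite oppr_ge0.
  - by rewrite !mulr_ge0 // ltW.
  - by rewrite sqrrN xx !exprMn r2.
subst gmm gmp gpm gpp.
have Em0 : gm0 = - (r * a * b) by apply: mk => //; clear -Nm; lra.
have Ep0 : gp0 = - (r * c * d) by apply: mk => //; clear -Np; lra.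
have E0m : g0m = - (r * a * c) by apply: mk => //; clear -Tm; lra.
have E0p : g0p = - (r * b * d) by apply: mk => //; clear -Tp; lra.
subst gm0 gp0 g0m g0p.
have E00 : g00 = - (a * d + b * c).
  rewrite -[LHS]opprK; congr (- _); apply: sq_eq.
  - by rewrite oppr_ge0 ltW.
  - by rewrite addr_ge0 // mulr_ge0.
  (* [N0] says [g00 ^+ 2 = 1 + 4 * a * b * c * d]; replacing [1] by this square, which comes from
     [Nmp], gives the square of [a * d + b * c]. *)
  - have : (a * d - b * c) ^+ 2 = 1.
      have : r ^+ 2 * (a * b * c * d) = 2 * (a * b * c * d) by rewrite r2.
      by clear -Nmp; nra.
    have : r ^+ 2 * (a * b * c * d) = 2 * (a * b * c * d) by rewrite r2.
    by clear -N0; nra.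
subst g00.
have W2 : (a * d - b * c) ^+ 2 = 1.
  have : r ^+ 2 * (a * b * c * d) = 2 * (a * b * c * d) by rewrite r2.
  by clear -Nmp; nra.
have W3 : 0 < (a * d - b * c) ^+ 3.
  move: D; congr (0 < _); transitivity
    ((a * d + b * c) * ((a * d) ^+ 2 - (b * c) ^+ 2)
     - r ^+ 2 * (2 * a * b * c * d) * (a * d - b * c)).
    by ring.
  by rewrite r2; ring.
have W : a * d - b * c = 1.
  move: W3 W2; move: (a * d - b * c) => x; clear => x3 /eqP.
  by rewrite sqrf_eq1 => /orP[/eqP->//|/eqP xE]; move: x3; rewrite xE; lra.
have ad : 0 < a * d by have := mulr_ge0 b0 c0; clear -W; lra.
have a1 : 0 < a by rewrite lt0r a0 andbT; apply/eqP => aE; move: ad; rewrite aE mul0r ltxx.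
have d1 : 0 < d by rewrite lt0r d0 andbT; apply/eqP => aE; move: ad; rewrite aE mulr0 ltxx.
by exists a, b, c, d.
Qed.

(** * Interior and closure tested along lines *)

Lemma interior_line (K : set (fintop V)) w u :
  interior K w -> exists2 e : R, 0 < e & K (w + e *: u).
Proof.
move=> Kw; have := @line_continuous w u 0.
move=> /(_ K); rewrite scale0r addr0 => /(_ Kw) /nbhs_ballP [e /= e0 sub].
exists (e / 2); first by rewrite divr_gt0.
by apply: sub; rewrite /ball /= sub0r normrN ger0_norm; lra.
Qed.

Lemma closure_line (K : set (fintop V)) w u :
  (forall e : R, 0 < e -> K (w + e *: u)) -> closure K w.
Proof.
move=> Ku B Bw; have := @line_continuous w u 0.
move=> /(_ B); rewrite scale0r addr0 => /(_ Bw) /nbhs_ballP [e /= e0 sub].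
exists (w + (e / 2) *: u); split; first by apply: Ku; rewrite divr_gt0.
by apply: sub; rewrite /ball /= sub0r normrN ger0_norm; lra.
Qed.

(** * Crooked halfspaces seen from their vertex, and their translations *)

Definition crooked_cone s v :=
  ((v ∙ dirp s < 0 /\ v ∙ dir s > 0) \/
   [/\ v ∙ dirp s < 0, v ∙ dirm s > 0 & v ∙ dir s = 0]) \/
  (v ∙ dirm s > 0 /\ v ∙ dir s < 0).

Definition closed_crooked_cone s v :=
  (v ∙ dirp s <= 0 /\ v ∙ dir s >= 0) \/ (v ∙ dirm s >= 0 /\ v ∙ dir s <= 0).

Definition translation_quadrant s v :=
  [/\ v ∙ dir s = 0, v ∙ dirp s <= 0 & v ∙ dirm s >= 0].

Lemma crooked_cone_translation s v :
  (forall u, crooked_cone s u -> crooked_cone s (u + v)) <-> translation_quadrant s v.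
Proof.
split=> [Hv|[v0 vp vm] u]; last first.
  rewrite /crooked_cone !formE v0 => -[[[? ?]|[? ? ?]]|[? ?]].
  - by left; left; split; lra.
  - by left; right; split; lra.
  - by right; split; lra.
(* The point [u] with frame products [x], [y], [z] lies in the cone, while [u + v] does not. *)
have absurd (x y z : R) : x < 0 /\ y > 0 \/ x > 0 /\ z < 0 ->
    (x + v ∙ dir s > 0 /\ z + v ∙ dirp s >= 0) \/
    (x + v ∙ dir s < 0 /\ y + v ∙ dirm s <= 0) -> False.
  have [u [<- <- <-]] := dir_realize s x y z => ux uvx.
  have : crooked_cone s (u + v).
    by apply: Hv; case: ux => ?; [right|left; left]; lra.
  rewrite /crooked_cone !formE => -[[[? ?]|[? ? ?]]|[? ?]]; lra.
have v0 : v ∙ dir s = 0.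
  have := ler_norm (- (v ∙ dirp s)); have := ler_norm (v ∙ dirm s).
  set n := `|_|; set m := `|_| => nE mE.
  apply/eqP; rewrite eq_le !leNgt; apply/andP; split; apply/negP => v0.
  (* Adding [v] flips the sign of this first product; [m] and [n] are large enough to keep the image
     out of the wedge on the other side. *)
  - by apply: (absurd (- (v ∙ dir s) / 2) 1 m); lra.
  - by apply: (absurd (- (v ∙ dir s) / 2) (- n) (-1)); lra.
split=> //; rewrite leNgt; apply/negP => v1.
- by apply: (absurd 1 0 (- (v ∙ dirp s) / 2)); lra.
- by apply: (absurd (-1) (- (v ∙ dirm s) / 2) 0); lra.
Qed.

(** A Farkas-type criterion for the wedge of [f1], [f2] and the translate by [w] of that of [g1],
    [g2], closed and then open. The converse comes later, from the signs of the normals on the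
    cones. *)
Definition wedges_meet f1 f2 g1 g2 w n :=
  (0 <= w ∙ n -> exists q, [/\ 0 <= q ∙ f1, 0 <= q ∙ f2,
                               0 <= (q - w) ∙ g1 & 0 <= (q - w) ∙ g2]) /\
  (0 < w ∙ n -> exists q, [/\ 0 < q ∙ f1, 0 < q ∙ f2,
                              0 < (q - w) ∙ g1 & 0 < (q - w) ∙ g2]).

(* With q . f1 = q . f2 = (q - w) . g2 = k, the two expressions of n make
   (q - w) . g1 an affine function of k, positive at a small k when w . n > 0. *)
Lemma wedges_meet_pivot (f1 f2 g1 g2 : V) (x y z : R) w (n : V) :
  0 < x -> 0 <= y -> 0 <= z ->
  n = x *: f1 + y *: f2 -> n = - (x *: g1 + z *: g2) ->
  (forall i j k : R, exists q, [/\ q ∙ f1 = i, q ∙ f2 = j & q ∙ g2 = k]) ->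
  wedges_meet f1 f2 g1 g2 w n.
Proof.
move=> x0 y0 z0 nf ng surj.
have H (k : R) : exists q, [/\ q ∙ f1 = k, q ∙ f2 = k, (q - w) ∙ g2 = k &
    x * ((q - w) ∙ g1) = w ∙ n - (x + y + z) * k].
  have [q [q1 q2 q3]] := surj k k (k + w ∙ g2).
  exists q; split=> //; first by rewrite formDl formNl q3 addrK.
  have qf : q ∙ n = (x + y) * k by rewrite nf !formE q1 q2 mulrDl.
  have := qf; rewrite {1}ng !formE q3.
  have : w ∙ n = - (x * (w ∙ g1) + z * (w ∙ g2)) by rewrite ng !formE.
  by lra.
split=> wn.
  have [q [q1 q2 q3 qx]] := H 0; exists q; rewrite q1 q2 q3; split=> //.
  by rewrite -(pmulr_rge0 _ x0) qx mulr0 subr0.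
have K0 : 0 < x + y + z by lra.
have [q [q1 q2 q3 qx]] := H (w ∙ n / (2 * (x + y + z))).
have k0 : 0 < w ∙ n / (2 * (x + y + z)) by rewrite divr_gt0 // mulr_gt0.
exists q; rewrite q1 q2 q3; split=> //; rewrite -(pmulr_rgt0 _ x0) qx.
rewrite (_ : _ - _ = w ∙ n / 2) ?divr_gt0 //.
by field; rewrite gt_eqF.
Qed.

(* The two wedges share a boundary plane: this replaces wedges_meet_pivot for
   the normals n12 and n21 below when b = 0 or c = 0. *)
Lemma wedges_meet_degenerate (f1 f2 g1 g2 : V) (x y z : R) w (n : V) :
  0 <= x -> 0 < y -> 0 < z ->
  n = z *: f2 -> g1 = f1 + x *: f2 -> g2 = - (y *: f2) ->
  (forall i j : R, exists q, q ∙ f1 = i /\ q ∙ f2 = j) ->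
  wedges_meet f1 f2 g1 g2 w n.
Proof.
move=> x0 y0 z0 -> -> -> surj.
(* The absolute value in [q ∙ f1] absorbs [w] in the [g1] condition, so the only real constraint
   left is [k] between 0 and [w ∙ f2]. *)
have H (k : R) : exists q, [/\ q ∙ f1 = k + `|w ∙ (f1 + x *: f2)|, q ∙ f2 = k,
    k <= (q - w) ∙ (f1 + x *: f2) - x * k
    & (q - w) ∙ (- (y *: f2)) = y * (w ∙ f2 - k)].
  have [q [q1 q2]] := surj (k + `|w ∙ (f1 + x *: f2)|) k.
  exists q; split=> //; last by rewrite !formE q2; ring.
  have := ler_norm (w ∙ (f1 + x *: f2)); move: q1; set m := `|_|.
  by rewrite !formE q2 => ->; lra.
rewrite /wedges_meet formZr; split=> wn.
  have [q [q1 q2 q3 q4]] := H 0; exists q; rewrite q1 q2 q4 add0r normr_ge0; split=> //.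
    by move: q3; rewrite mulr0 subr0.
  by rewrite subr0 mulr_ge0 ?(ltW y0) // -(pmulr_rge0 _ z0).
have w0 : 0 < w ∙ f2 by rewrite -(pmulr_rgt0 _ z0).
have [q [q1 q2 q3 q4]] := H (w ∙ f2 / 2); exists q; rewrite q1 q2 q4; split.
- by rewrite ltr_pwDl // divr_gt0.
- by rewrite divr_gt0.
- have : 0 <= x * (w ∙ f2 / 2) by rewrite mulr_ge0 // ltW // divr_gt0.
  by lra.
- by rewrite mulr_gt0 //; lra.
Qed.

Lemma form_inj s u v : (forall q, q ∙ u = q ∙ v) -> u = v.
Proof.
move=> uv; rewrite (dir_expansion s u) (dir_expansion s v).
by rewrite ![u ∙ _]formC ![v ∙ _]formC !uv.
Qed.

Lemma comb_ge0 (x y i j : R) : 0 <= x -> 0 <= i -> 0 <= y -> j <= 0 -> 0 <= x * i - y * j.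
Proof. by move=> x0 i0 y0 j0; rewrite subr_ge0 (le_trans (mulr_ge0_le0 y0 j0)) ?mulr_ge0. Qed.

Lemma comb_gt0l (x y i j : R) : 0 < x -> 0 < i -> 0 <= y -> j <= 0 -> 0 < x * i - y * j.
Proof. by move=> x0 i0 y0 j0; rewrite subr_gt0 (le_lt_trans (mulr_ge0_le0 y0 j0)) ?mulr_gt0. Qed.

Lemma comb_gt0r (x y i j : R) : 0 <= x -> 0 <= i -> 0 < y -> j < 0 -> 0 < x * i - y * j.
Proof. by move=> x0 i0 y0 j0; rewrite subr_gt0 (lt_le_trans (y := 0)) ?mulr_ge0 // pmulr_rlt0. Qed.

(** * Facet normals in terms of the spinor entries *)

Section NormalForm.
Context (s1 s2 : director M) (a b c d r : R).
Context (a_gt0 : 0 < a) (b_ge0 : 0 <= b) (c_ge0 : 0 <= c) (d_gt0 : 0 < d).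
Context (det1 : a * d - b * c = 1) (r_gt0 : 0 < r) (r2 : r * r = 2).
Context (dirE12 : forall q, q ∙ dir s1 = - (a * d + b * c) * (q ∙ dir s2)
    + r * b * d * (q ∙ dirm s2) + r * a * c * (q ∙ dirp s2)).
Context (dirmE12 : forall q, q ∙ dirm s1 = - (r * a * b) * (q ∙ dir s2)
    + b ^+ 2 * (q ∙ dirm s2) + a ^+ 2 * (q ∙ dirp s2)).
Context (dirpE12 : forall q, q ∙ dirp s1 = - (r * c * d) * (q ∙ dir s2)
    + d ^+ 2 * (q ∙ dirm s2) + c ^+ 2 * (q ∙ dirp s2)).

(* nij belongs to the dual cone of the i-th wedge of s2 and to minus that of the
   j-th wedge of s1, the first wedge being the one in {v . s >= 0}. *)
Let n11 := d *: dir s2 - (r * c) *: dirp s2.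
Let n12 := b *: dir s2 - (r * a) *: dirp s2.
Let n21 := (r * d) *: dirm s2 - c *: dir s2.
Let n22 := (r * b) *: dirm s2 - a *: dir s2.

(** This and the next three lemmas express the normals in the frame of [s1]. After pairing with [q],
    the explicit multipliers of [r2] and [det1] make the identity linear. *)
Lemma n11E : n11 = (r * b) *: dirp s1 - d *: dir s1.
Proof.
apply: (@form_inj s2) => q; rewrite /n11 !formE dirE12 dirpE12.
move: (q ∙ _ s2) (q ∙ _ s2) (q ∙ _ s2) => x y z.
have := congr1 (fun t => t * (b * c * d * z)) r2.
have := congr1 (fun t => t * (d * z - r * c * y)) det1.
by rewrite /=; lra.
Qed.

Lemma n12E : n12 = b *: dir s1 - (r * d) *: dirm s1.
Proof.
apply: (@form_inj s2) => q; rewrite /n12 !formE dirE12 dirmE12.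
move: (q ∙ _ s2) (q ∙ _ s2) (q ∙ _ s2) => x y z.
have := congr1 (fun t => t * (a * b * d * z)) r2.
have := congr1 (fun t => t * (b * z - r * a * y)) det1.
by rewrite /=; lra.
Qed.

Lemma n21E : n21 = (r * a) *: dirp s1 - c *: dir s1.
Proof.
apply: (@form_inj s2) => q; rewrite /n21 !formE dirE12 dirpE12.
move: (q ∙ _ s2) (q ∙ _ s2) (q ∙ _ s2) => x y z.
have := congr1 (fun t => t * (a * c * d * y)) r2.
have := congr1 (fun t => t * (r * d * z - c * y)) det1.
by rewrite /=; lra.
Qed.

Lemma n22E : n22 = a *: dir s1 - (r * c) *: dirm s1.
Proof.
apply: (@form_inj s2) => q; rewrite /n22 !formE dirE12 dirmE12.
move: (q ∙ _ s2) (q ∙ _ s2) (q ∙ _ s2) => x y z.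
have := congr1 (fun t => t * (a * b * c * y)) r2.
have := congr1 (fun t => t * (r * b * z - a * y)) det1.
by rewrite /=; lra.
Qed.

Lemma meet11 w : wedges_meet (dir s2) (- dirp s2) (dir s1) (- dirp s1) w n11.
Proof.
apply: (@wedges_meet_pivot _ _ _ _ d (r * c) (r * b)) => //;
  rewrite ?mulr_ge0 // ?(ltW r_gt0) //.
- by rewrite /n11 scalerN.
- by rewrite n11E scalerN opprB.
move=> i j k.
(* The middle entry solves [dirpE12] for [q ∙ dirm s2], given that [q ∙ dirp s1] must be [- k]. *)
have [q [q0 qm qp]] := dir_realize s2 i ((- k + r * c * d * i + c ^+ 2 * j) / d ^+ 2) (- j).
exists q; rewrite !formNr dirpE12 q0 qm qp; split=> //; first by rewrite opprK.
by field; rewrite gt_eqF.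
Qed.

Lemma meet22 w : wedges_meet (- dir s2) (dirm s2) (- dir s1) (dirm s1) w n22.
Proof.
apply: (@wedges_meet_pivot _ _ _ _ a (r * b) (r * c)) => //;
  rewrite ?mulr_ge0 // ?(ltW r_gt0) //.
- by rewrite /n22 scalerN addrC.
- by rewrite n22E scalerN opprD opprK.
move=> i j k.
have [q [q0 qm qp]] := dir_realize s2 (- i) j ((k - r * a * b * i - b ^+ 2 * j) / a ^+ 2).
exists q; rewrite !formNr dirmE12 q0 qm qp; split=> //; first by rewrite opprK.
by field; rewrite gt_eqF.
Qed.

Lemma meet12 w : wedges_meet (dir s2) (- dirp s2) (- dir s1) (dirm s1) w n12.
Proof.
(* When [b = 0], [dirm s1] is [a ^+ 2] times [dirp s2]. *)
move: b_ge0; rewrite le_eqVlt => /predU1P[b0|b_gt0].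
  have ad : a * d = 1 by rewrite -det1 -b0 mul0r subr0.
  apply: (@wedges_meet_degenerate _ _ _ _ (r * a * c) (a ^+ 2) (r * a)) => //.
  - by rewrite !mulr_ge0 // ltW.
  - by rewrite exprn_gt0.
  - by rewrite mulr_gt0.
  - by rewrite /n12 -b0 scale0r add0r scalerN.
  - apply: (@form_inj s2) => q; rewrite !formE dirE12 -b0 ad; ring.
  - apply: (@form_inj s2) => q; rewrite !formE dirmE12 -b0; ring.
  - move=> i j; have [q [q0 _ qp]] := dir_realize s2 i 0 (- j).
    by exists q; rewrite formNr q0 qp opprK.
apply: (@wedges_meet_pivot _ _ _ _ b (r * a) (r * d)) => //;
  rewrite ?mulr_ge0 ?(ltW r_gt0) ?(ltW a_gt0) ?(ltW d_gt0) //.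
- by rewrite /n12 scalerN.
- by rewrite n12E scalerN opprD opprK.
move=> i j k.
have [q [q0 qm qp]] := dir_realize s2 i ((k + r * a * b * i + a ^+ 2 * j) / b ^+ 2) (- j).
exists q; rewrite !formNr dirmE12 q0 qm qp; split=> //; first by rewrite opprK.
by field; rewrite gt_eqF.
Qed.

Lemma meet21 w : wedges_meet (- dir s2) (dirm s2) (dir s1) (- dirp s1) w n21.
Proof.
move: c_ge0; rewrite le_eqVlt => /predU1P[c0|c_gt0].
  have ad : a * d = 1 by rewrite -det1 -c0 mulr0 subr0.
  apply: (@wedges_meet_degenerate _ _ _ _ (r * b * d) (d ^+ 2) (r * d)) => //.
  - by rewrite !mulr_ge0 // ltW.
  - by rewrite exprn_gt0.
  - by rewrite mulr_gt0.
  - by rewrite /n21 -c0 scale0r subr0.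
  - apply: (@form_inj s2) => q; rewrite !formE dirE12 -c0 ad; ring.
  - apply: (@form_inj s2) => q; rewrite !formE dirpE12 -c0; ring.
  - move=> i j; have [q [q0 qm _]] := dir_realize s2 (- i) j 0.
    by exists q; rewrite formNr q0 qm opprK.
apply: (@wedges_meet_pivot _ _ _ _ c (r * d) (r * a)) => //;
  rewrite ?mulr_ge0 ?(ltW r_gt0) ?(ltW a_gt0) ?(ltW d_gt0) //.
- by rewrite /n21 scalerN addrC.
- by rewrite n21E scalerN opprB.
move=> i j k.
have [q [q0 qm qp]] := dir_realize s2 (- i) j ((- k - r * c * d * i - d ^+ 2 * j) / c ^+ 2).
exists q; rewrite !formNr dirpE12 q0 qm qp; split=> //; first by rewrite opprK.
by field; rewrite gt_eqF.
Qed.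

Let weights_ge0 := (ltW r_gt0, b_ge0, c_ge0, ltW a_gt0, ltW d_gt0, mulr_ge0 (ltW r_gt0) (ltW a_gt0),
  mulr_ge0 (ltW r_gt0) (ltW d_gt0), mulr_ge0 (ltW r_gt0) b_ge0,
  mulr_ge0 (ltW r_gt0) c_ge0, mulr_gt0 r_gt0 a_gt0, mulr_gt0 r_gt0 d_gt0).

(** Each normal is a nonnegative combination of the two forms bounding its wedge of [s2]. Any row
    index obtained here and any column index obtained for [s1] share one normal. *)
Lemma normals_closed_cone2 q : closed_crooked_cone s2 q ->
  (0 <= q ∙ n11 /\ 0 <= q ∙ n12) \/ (0 <= q ∙ n21 /\ 0 <= q ∙ n22).
Proof.
rewrite /n11 /n12 /n21 /n22 !formE => -[[p0 x0]|[m0 x0]]; [left|right];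
  by split; rewrite comb_ge0 ?weights_ge0.
Qed.

Lemma normals_closed_cone1 q : closed_crooked_cone s1 q ->
  (q ∙ n11 <= 0 /\ q ∙ n21 <= 0) \/ (q ∙ n12 <= 0 /\ q ∙ n22 <= 0).
Proof.
rewrite n11E n12E n21E n22E !formE => -[[p0 x0]|[m0 x0]]; [left|right];
  by split; rewrite -oppr_ge0 opprB comb_ge0 ?weights_ge0.
Qed.

(** On the hinge, where [q ∙ dir s2 = 0], strictness can fail for [n11] and [n22], whose null
    weights involve [c] and [b]; it survives for [n12] and [n21], with weights [r * a] and [r * d].
    Hence the third case. *)
Lemma normals_cone2 q : crooked_cone s2 q ->
  [\/ 0 < q ∙ n11 /\ 0 < q ∙ n12, 0 < q ∙ n21 /\ 0 < q ∙ n22 |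
      0 < q ∙ n12 /\ 0 < q ∙ n21].
Proof.
rewrite /n11 /n12 /n21 /n22 !formE => -[[[p0 x0]|[p0 m0 ->]]|[m0 x0]].
- apply: Or31; split; [apply: comb_gt0l|apply: comb_gt0r];
  by rewrite ?weights_ge0 // ltW.
- by apply: Or33; rewrite !mulr0 subr0 sub0r oppr_gt0 pmulr_rlt0 ?pmulr_rgt0 ?weights_ge0.
- apply: Or32; split; [apply: comb_gt0l|apply: comb_gt0r];
  by rewrite ?weights_ge0 // ltW.
Qed.

Lemma normals_cone1 q : crooked_cone s1 q ->
  [\/ q ∙ n11 < 0 /\ q ∙ n21 < 0, q ∙ n12 < 0 /\ q ∙ n22 < 0 |
      q ∙ n12 < 0 /\ q ∙ n21 < 0].
Proof.
rewrite n11E n12E n21E n22E !formE => -[[[p0 x0]|[p0 m0 ->]]|[m0 x0]].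
- apply: Or31; rewrite -oppr_gt0 opprB -(oppr_gt0 (_ - _)) opprB; split;
  [apply: comb_gt0l|apply: comb_gt0r]; by rewrite ?weights_ge0 // ltW.
- by apply: Or33; rewrite !mulr0 subr0 sub0r oppr_lt0 pmulr_rlt0 ?pmulr_rgt0 ?weights_ge0.
- apply: Or32; rewrite -oppr_gt0 opprB -(oppr_gt0 (_ - _)) opprB; split;
  [apply: comb_gt0l|apply: comb_gt0r]; by rewrite ?weights_ge0 // ltW.
Qed.
Lemma form_split w q n : w ∙ n = q ∙ n - (q - w) ∙ n.
Proof. by rewrite !formE; ring. Qed.

Lemma closed_cones_disjoint w :
  (forall q, closed_crooked_cone s2 q -> ~ closed_crooked_cone s1 (q - w)) <->
  [/\ w ∙ n11 < 0, w ∙ n12 < 0, w ∙ n21 < 0 & w ∙ n22 < 0].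
Proof.
split=> [disj|[w11 w12 w21 w22] q H2 H1].
  split; rewrite ltNge; apply/negP.
  - move=> /(meet11 w).1[q [x1 x2 x3 x4]]; rewrite !formNr in x2 x4.
    by apply: (disj q); left; lra.
  - move=> /(meet12 w).1[q [x1 x2 x3 x4]]; rewrite !formNr in x2 x3.
    by apply: (disj q); [left|right]; lra.
  - move=> /(meet21 w).1[q [x1 x2 x3 x4]]; rewrite !formNr in x1 x4.
    by apply: (disj q); [right|left]; lra.
  - move=> /(meet22 w).1[q [x1 x2 x3 x4]]; rewrite !formNr in x1 x3.
    by apply: (disj q); right; lra.
move: w11 w12 w21 w22; rewrite !(form_split w q).
by have := normals_closed_cone2 H2; have := normals_closed_cone1 H1; lra.
Qed.

Lemma cones_disjoint w :
  (forall q, crooked_cone s2 q -> ~ crooked_cone s1 (q - w)) <->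
  [/\ w ∙ n11 <= 0, w ∙ n12 <= 0, w ∙ n21 <= 0 & w ∙ n22 <= 0].
Proof.
split=> [disj|[w11 w12 w21 w22] q H2 H1].
  split; rewrite leNgt; apply/negP.
  - move=> /(meet11 w).2[q [x1 x2 x3 x4]]; rewrite !formNr in x2 x4.
    by apply: (disj q); left; left; lra.
  - move=> /(meet12 w).2[q [x1 x2 x3 x4]]; rewrite !formNr in x2 x3.
    by apply: (disj q); [left; left|right]; lra.
  - move=> /(meet21 w).2[q [x1 x2 x3 x4]]; rewrite !formNr in x1 x4.
    by apply: (disj q); [right|left; left]; lra.
  - move=> /(meet22 w).2[q [x1 x2 x3 x4]]; rewrite !formNr in x1 x3.
    by apply: (disj q); right; lra.
move: w11 w12 w21 w22; rewrite !(form_split w q).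
(* In each of the nine cases some normal occurs on both sides, and [form_split] makes its product
   with [w] positive. *)
by case: (normals_cone2 H2) => -[? ?]; case: (normals_cone1 H1) => -[? ?]; lra.
Qed.

(** * The cone of differences of translations, its interior and its closure *)

Let K : set (fintop V) :=
  [set v1 - v2 | v1 in translation_quadrant s1 & v2 in translation_quadrant s2].

Lemma quadrant_normals1 v : translation_quadrant s1 v ->
  [/\ v ∙ n11 <= 0, v ∙ n12 <= 0, v ∙ n21 <= 0 & v ∙ n22 <= 0].
Proof.
rewrite n11E n12E n21E n22E => -[v0 vp vm]; rewrite !formE v0 !mulr0 !subr0 !sub0r.
by split; rewrite ?oppr_le0 ?mulr_ge0_le0 ?mulr_ge0 ?weights_ge0.
Qed.

Lemma quadrant_normals2 v : translation_quadrant s2 v ->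
  [/\ 0 <= v ∙ n11, 0 <= v ∙ n12, 0 <= v ∙ n21 & 0 <= v ∙ n22].
Proof.
rewrite /n11 /n12 /n21 /n22 => -[v0 vp vm]; rewrite !formE v0 !mulr0 !subr0 !sub0r.
by split; rewrite ?oppr_ge0 ?mulr_ge0_le0 ?mulr_ge0 ?weights_ge0.
Qed.

Lemma quadrant_differenceE w : K w <->
  [/\ w ∙ n11 <= 0, w ∙ n12 <= 0, w ∙ n21 <= 0 & w ∙ n22 <= 0].
Proof.
split=> [[v1 /quadrant_normals1[? ? ? ?] [v2 /quadrant_normals2[? ? ? ?] <-]]|].
  by rewrite !(formDl v1) !(formNl v2); split; lra.
rewrite n11E n12E n21E n22E !formE => -[w11 w12 w21 w22].
have wK v2 : translation_quadrant s2 v2 -> translation_quadrant s1 (w + v2) -> K w.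
  by move=> v2K v1K; exists (w + v2) => //; exists v2 => //; rewrite addrK.
(* On this plane, [n12] and [n21] alone put [w] in the quadrant of [s1]. *)
have wK0 : w ∙ dir s1 = 0 -> K w.
  move=> w0; move: w12 w21; rewrite w0 !mulr0 !subr0 sub0r oppr_le0.
  rewrite pmulr_rge0 ?pmulr_rle0 ?weights_ge0 // => w12 w21.
  by apply: (wK 0); rewrite /translation_quadrant ?addr0 ?form0l ?lexx.
(* The plane of s1^-, s1^+ cuts the cone into two simplicial cones, with third
   generator s2^+ on this side and - s2^- on the other. *)
have [w0|w0] := lerP (w ∙ dir s1) 0.
  move: b_ge0; rewrite le_eqVlt => /predU1P[b0|b_gt0].
    apply: wK0; apply/eqP; rewrite eq_le w0 /=.
    by move: w11; rewrite -b0 mulr0 mul0r sub0r oppr_le0 pmulr_rge0.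
  have rbd : 0 < r * b * d by rewrite !mulr_gt0.
  (* This [k] makes [w - k *: dirp s2] orthogonal to [dir s1], as
     [dirp s2 ∙ dir s1 = - (r * b * d)]. *)
  pose k := - (w ∙ dir s1) / (r * b * d).
  have k0 : 0 <= k by rewrite divr_ge0 ?oppr_ge0 // ltW.
  apply: (wK (- (k *: dirp s2))); rewrite /translation_quadrant !formE.
    by rewrite !dirE; split; lra.
  rewrite !(dirE12 (dirp s2), dirmE12 (dirp s2), dirpE12 (dirp s2)) !dirE; split.
  - by rewrite /k; field; rewrite !gt_eqF.
  (* Multiplied by [r * b], the left side is exactly [w ∙ n11]; in the next goal, multiplication by
     [r * d] gives [- (w ∙ n12)]. *)
  - rewrite -(pmulr_rle0 _ (mulr_gt0 r_gt0 b_gt0)) (le_trans _ w11) // le_eqVlt.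
    by apply/orP; left; apply/eqP; rewrite /k; field; rewrite !gt_eqF.
  - rewrite -(pmulr_rge0 _ (mulr_gt0 r_gt0 d_gt0)) -oppr_le0 (le_trans _ w12) // le_eqVlt.
    by apply/orP; left; apply/eqP; rewrite /k; field; rewrite !gt_eqF.
move: c_ge0; rewrite le_eqVlt => /predU1P[c0|c_gt0].
  apply: wK0; apply/eqP; rewrite eq_le (ltW w0) andbT.
  by move: w22; rewrite -c0 mulr0 mul0r subr0 pmulr_rle0.
have rac : 0 < r * a * c by rewrite !mulr_gt0.
pose k := (w ∙ dir s1) / (r * a * c).
have k0 : 0 <= k by rewrite divr_ge0 // ltW.
apply: (wK (k *: dirm s2)); rewrite /translation_quadrant !formE.
  by rewrite !dirE; split; lra.
rewrite !(dirE12 (dirm s2), dirmE12 (dirm s2), dirpE12 (dirm s2)) !dirE; split.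
- by rewrite /k; field; rewrite !gt_eqF.
- rewrite -(pmulr_rle0 _ (mulr_gt0 r_gt0 a_gt0)) (le_trans _ w21) // le_eqVlt.
  by apply/orP; left; apply/eqP; rewrite /k; field; rewrite !gt_eqF.
- rewrite -(pmulr_rge0 _ (mulr_gt0 r_gt0 c_gt0)) -oppr_le0 (le_trans _ w22) // le_eqVlt.
  by apply/orP; left; apply/eqP; rewrite /k; field; rewrite !gt_eqF.
Qed.

(** An interior point can still move in a direction of positive product with a given normal, so its
    own product is negative. Conversely the strict inequalities cut out an open subset of [K]. *)
Lemma interior_quadrant_difference w : interior K w <->
  [/\ w ∙ n11 < 0, w ∙ n12 < 0, w ∙ n21 < 0 & w ∙ n22 < 0].
Proof.
split=> [Kw|[w11 w12 w21 w22]].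
  have strict n : (forall u, K u -> u ∙ n <= 0) -> (exists u, 0 < u ∙ n) -> w ∙ n < 0.
    move=> Kn [u un]; have [e e0 /Kn] := interior_line u Kw.
    by rewrite !formE; have := mulr_gt0 e0 un; lra.
  have ra := mulr_gt0 r_gt0 a_gt0; have rd := mulr_gt0 r_gt0 d_gt0.
  split; apply: strict => [u /quadrant_differenceE[]//|].
  - by exists (dir s2); rewrite /n11 !formE !dirE; have := d_gt0; lra.
  - by exists (dirm s2); rewrite /n12 !formE !dirE; lra.
  - by exists (- dirp s2); rewrite /n21 !formE !dirE; lra.
  - by exists (- dir s2); rewrite /n22 !formE !dirE; have := a_gt0; lra.
have : nbhs (w : fintop V) (([set u | u ∙ n11 < 0] `&` [set u | u ∙ n12 < 0]) `&`
    ([set u | u ∙ n21 < 0] `&` [set u | u ∙ n22 < 0])).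
  apply: open_nbhs_nbhs; split=> //.
  by apply: openI; apply: openI; exact: open_form_lt0.
by apply: filterS => u [[? ?] [? ?]]; apply/quadrant_differenceE; split; apply: ltW.
Qed.

Lemma closure_quadrant_difference w : 0 < b + c -> closure (interior K) w <->
  [/\ w ∙ n11 <= 0, w ∙ n12 <= 0, w ∙ n21 <= 0 & w ∙ n22 <= 0].
Proof.
move=> bc; split=> [Kw|[w11 w12 w21 w22]].
  have weak n : (forall u, interior K u -> u ∙ n < 0) -> w ∙ n <= 0.
    move=> Kn; have sub : interior K `<=` ([set u | u ∙ n <= 0] : set (fintop V)).
      by move=> u /Kn /ltW.
    have := closureS sub Kw.
    by rewrite -((closure_id _).1 (@closed_form_le0 n)).
  by split; apply: weak => u /interior_quadrant_difference[].
(* The direction is the sum of the four generating rays of the cone. Its product is [- r * (b + c)]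
   with [n11] and [n22], and [- r * (a + d)] with [n12] and [n21], so it points strictly inside. *)
apply: (@closure_line _ _ (dirm s1 - dirp s1 - dirm s2 + dirp s2)) => e e0.
apply/interior_quadrant_difference.
have step n : w ∙ n <= 0 -> (dirm s1 - dirp s1) ∙ n + (dirp s2 - dirm s2) ∙ n < 0 ->
    (w + e *: (dirm s1 - dirp s1 - dirm s2 + dirp s2)) ∙ n < 0.
  by move=> wn; rewrite -(pmulr_rlt0 _ e0) !formE; lra.
split; apply: step => //.
- rewrite {1}n11E /n11 !formE !dirE.
  have := mulr_gt0 r_gt0 bc; lra.
- rewrite {1}n12E /n12 !formE !dirE.
  by have := mulr_gt0 r_gt0 a_gt0; have := mulr_gt0 r_gt0 d_gt0; lra.
- rewrite {1}n21E /n21 !formE !dirE.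
  by have := mulr_gt0 r_gt0 a_gt0; have := mulr_gt0 r_gt0 d_gt0; lra.
- rewrite {1}n22E /n22 !formE !dirE.
  have := mulr_gt0 r_gt0 bc; lra.
Qed.

Lemma opposite_dir : b + c <= 0 -> dir s2 = - dir s1.
Proof.
move=> bc; have b0 : b = 0 by have := b_ge0; have := c_ge0; lra.
have c0 : c = 0 by have := c_ge0; lra.
move: det1; rewrite b0 mul0r subr0 => ad.
by apply: (@form_inj s2) => q; rewrite formNr dirE12 b0 c0 ad; ring.
Qed.

Lemma closed_cones_disjoint_interior w :
  (forall q, closed_crooked_cone s2 q -> ~ closed_crooked_cone s1 (q - w)) <->
  interior K w.
Proof.
exact: iff_trans (closed_cones_disjoint w) (iff_sym (interior_quadrant_difference w)).
Qed.

Lemma cones_disjoint_closure w : dir s2 <> - dir s1 ->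
  (forall q, crooked_cone s2 q -> ~ crooked_cone s1 (q - w)) <->
  closure (interior K) w.
Proof.
move=> s12; have bc : 0 < b + c.
  by rewrite ltNge; apply/negP => bc; apply: s12; exact: opposite_dir.
exact: iff_trans (cones_disjoint w) (iff_sym (closure_quadrant_difference w bc)).
Qed.

End NormalForm.

Lemma spinor_expansion s1 s2 : consistently_oriented s1 s2 ->
  exists a b c d r : R,
  [/\ 0 < a, 0 <= b, 0 <= c, 0 < d & a * d - b * c = 1] /\ 0 < r /\ r * r = 2 /\
  [/\ forall q, q ∙ dir s1 = - (a * d + b * c) * (q ∙ dir s2)
        + r * b * d * (q ∙ dirm s2) + r * a * c * (q ∙ dirp s2),
      forall q, q ∙ dirm s1 = - (r * a * b) * (q ∙ dir s2)
        + b ^+ 2 * (q ∙ dirm s2) + a ^+ 2 * (q ∙ dirp s2) &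
      forall q, q ∙ dirp s1 = - (r * c * d) * (q ∙ dir s2)
        + d ^+ 2 * (q ∙ dirm s2) + c ^+ 2 * (q ∙ dirp s2)].
Proof.
move=> /gram_spinor[a [b [c [d [abcd [g00 g0m g0p [gm0 gmm gmp [gp0 gpm gpp]]]]]]]].
exists a, b, c, d, (Num.sqrt 2); split=> //; split; first by rewrite sqrtr_gt0 ltr0n.
split; first by rewrite -expr2 sqr_sqrtr ?ler0n.
split=> q; rewrite (form_expansion s2 q (_ s1)).
- by rewrite g00 g0m g0p; ring.
- by rewrite gm0 gmm gmp; ring.
- by rewrite gp0 gpm gpp; ring.
Qed.

(** * From vectors back to points of the affine space *)

Section Affine.
Context (E : affine_space V).
Implicit Types p : E.

Lemma pdiff_transD p (q : E) v : pdiff (trans q v) p = pdiff q p + v.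
Proof. by rewrite -{1}(trans_pdiff p q) transD pdiff_trans. Qed.

Lemma pdiff_chasles p1 p2 (q : E) : pdiff q p1 = pdiff q p2 - pdiff p1 p2.
Proof. by rewrite -{2}(trans_pdiff p1 q) pdiff_transD addrC addKr. Qed.

(** The point [p] identifies [E] with [V]; over an empty [E] the semigroup condition would be
    vacuous. *)
Lemma translational_semigroupE p s :
  translational_semigroup E s = translation_quadrant s.
Proof.
apply/seteqP; split=> v.
  move=> vH; apply/crooked_cone_translation => u Hu.
  rewrite -(pdiff_trans p u) -pdiff_transD; apply: (vH p).
  by exists (trans p u) => //; rewrite -(pdiff_trans p u) in Hu.
move=> /crooked_cone_translation vH p' _ [q Hq <-].
by have := vH _ Hq; rewrite -pdiff_transD.
Qed.

Lemma disjoint_translates p1 p2 (C1 C2 : set V) :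
  [set q : E | C1 (pdiff q p1)] `&` [set q | C2 (pdiff q p2)] = set0 <->
  forall v, C2 v -> ~ C1 (v - pdiff p1 p2).
Proof.
split=> [disj v C2v C1v|disj].
  suff : (set0 : set E) (trans p2 v) by [].
  by rewrite -disj; split; rewrite /= ?(pdiff_chasles p1 p2) pdiff_trans.
apply/seteqP; split=> // q [/= C1q C2q].
by apply: (disj _ C2q); rewrite -pdiff_chasles.
Qed.

End Affine.
End Lorentz.

Theorem theorem6p2 (R : realType) (V : vectType R) (M : minkowski_vect V)
    (E : affine_space V) (s1 s2 : director M) (p1 p2 : E) :
  consistently_oriented s1 s2 ->
  (closed_crooked_halfspace p1 s1 `&` closed_crooked_halfspace p2 s2 = set0
     <-> allowable_translations E s1 s2 (pdiff p1 p2)) /\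
  (dir s2 <> - dir s1 ->
   (crooked_halfspace p1 s1 `&` crooked_halfspace p2 s2 = set0
     <-> @closure (fintop V) (allowable_translations E s1 s2) (pdiff p1 p2))).
Proof.
move=> /spinor_expansion.
move=> [a [b [c [d [r [[a0 b0 c0 d0 W] [r0 [r2 [E0 Em Ep]]]]]]]]].
rewrite /allowable_translations !(translational_semigroupE p1).
split=> [|s12].
(* By conversion, a halfspace is the preimage of its cone under subtraction of the vertex. *)
- apply: iff_trans (disjoint_translates p1 p2 (closed_crooked_cone s1) (closed_crooked_cone s2)) _.
  exact: closed_cones_disjoint_interior E0 Em Ep _.
- apply: iff_trans (disjoint_translates p1 p2 (crooked_cone s1) (crooked_cone s2)) _.
  exact: cones_disjoint_closure E0 Em Ep _ s12.
Qed.
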